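(* Let $G^*$ be a finite subgroup of $SU(2)$ such that the representation of $G^*$ on $V_1$ is irreducible, and let $\chi_{V_1}$ be the character of $V_1$. Let $f\in V_n$ ($n\ge1$) be an invariant of $G^*$ with character $\chi_f$, and let $\mathrm{span}\{g_1,\dots,g_k\}\subset V_m$ be an irreducible representation of $G^*$ with character $\chi'$. Then: (1) $\mathrm{span}\{\frac{\partial f}{\partial u},\frac{\partial f}{\partial v}\}\subset V_{n-1}$ is an irreducible representation of $G^*$ with character $\chi_f\chi_{V_1}$. In particular, $-\frac{\partial f}{\partial v}\otimes e_1+\frac{\partial f}{\partial u}\otimes e_2$ spans a $1$-dimensional invariant subspace with character $\chi_f$ in $V_{n-1}\otimes\mathbb C^2$. Likewise, $u\otimes e_1+v\otimes e_2$ spans a $1$-dimensional invariant subspace (of $V_1\otimes\mathbb C^2$). (2) $\mathrm{span}\{fg_1,fg_2,\dots,fg_k\}\subset V_{n+m}$ is an irreducible representation of $G^*$ with character $\chi_f\chi'$.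
   Context: $V_n$ is the complex vector space of binary forms of degree $n$ in $u,v$, on which $SL_2(\mathbb C)$ acts by $(A\cdot f)(u,v)=f(A^{-1}(u,v)^T)$. A nonzero $f\in V_n$ is an invariant of a finite subgroup $G^*\subset SU(2)$ if $\mathrm{span}\{f\}$ is stable under $G^*$; $\chi_f$ denotes the character of this $1$-dimensional representation. $e_1,e_2$ is the standard basis of $\mathbb C^2$ with the standard action of $SL_2(\mathbb C)$ by matrix multiplication on column vectors; writing $p\otimes e_1+q\otimes e_2$ as $(p,q)$, the tensor product action on $V_n\otimes\mathbb C^2$ is $A:(p,q)\mapsto(A\cdot p,A\cdot q)A^T$. *)

(* Defs.v *)
From HB Require Import structures.
From mathcomp Require Import all_boot all_order all_algebra.
From mathcomp Require Export finmap reals complex mpoly spectral.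

Set Implicit Arguments.
Unset Strict Implicit.
Unset Printing Implicit Defensive.

Import GRing.Theory.
Local Open Scope ring_scope.

Section Representations.
Variables (C : fieldType) (V : vectType C).
Variables (G : {fset 'M[C]_2}) (act : 'M[C]_2 -> V -> V).
Implicit Types U W : {vspace V}.

Definition stable U : Prop :=
  forall A w, A \in G -> w \in U -> act A w \in U.

Definition irreducible_rep U : Prop :=
  [/\ stable U, U != 0%VS &
      forall W, (W <= U)%VS -> stable W -> W = 0%VS \/ W = U].

Definition one_dim_invariant_subspace U : Prop := stable U /\ \dim U = 1%N.

(* Trace of the endomorphism of U induced by A, in the basis vbasis U (vectors *)
(* as rows); only meaningful when act is linear and U is stable under A.       *)
Definition character U (A : 'M[C]_2) : C :=
  \tr (\matrix_(i < \dim U, j < \dim U)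
         coord (vbasis U) j (act A (vbasis U)`_i)).

End Representations.

Definition finite_subgroup_SU2 (C : numClosedFieldType)
    (G : {fset 'M[C]_2}) : Prop :=
  [/\ 1%:M \in G,
      forall A B, A \in G -> B \in G -> A *m B \in G,
      forall A, A \in G -> invmx A \in G &
      forall A, A \in G -> A \is unitarymx /\ \det A = 1].

Notation "''V[' C ]_ n" := (dhomog 2 C n)
  (at level 8, n at level 2, format "''V[' C ]_ n").

Section BinaryForms.
Variable C : fieldType.

(* The variables: index 0 is u, index 1 is v. *)
Lemma form_var_subproof (i : 'I_2) : ('X_i : {mpoly C[2]}) \is 1.-homog.
Proof. by rewrite dhomogX /= mdeg1. Qed.

Definition form_var (i : 'I_2) : 'V[C]_1 := DHomog (form_var_subproof i).
Definition form_u : 'V[C]_1 := form_var 0.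
Definition form_v : 'V[C]_1 := form_var 1.

(* The two entries of the column B (u, v)^T. *)
Definition lin_subst (B : 'M[C]_2) : 2.-tuple {mpoly C[2]} :=
  [tuple \sum_j B i j *: 'X_j | i < 2].

Lemma lin_subst_homog (B : 'M[C]_2) i : tnth (lin_subst B) i \is 1.-homog.
Proof.
by rewrite tnth_mktuple; apply: rpred_sum => j _; apply/rpredZ/form_var_subproof.
Qed.

Lemma form_act_subproof n (A : 'M[C]_2) (f : 'V[C]_n) :
  (f : {mpoly C[2]}) \mPo lin_subst (invmx A) \is n.-homog.
Proof.
rewrite comp_mpolyE big_seq; apply: rpred_sum => m m_f; apply: rpredZ.
have /dhomogP/(_ m m_f) /= <- := dhomog_is_dhomog f.
rewrite mdegE; elim/big_ind2: _ => [|p d q e hp hq|i _].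
- exact: dhomog1.
- exact: dhomogM.
by have := dhomogMn (m i) (lin_subst_homog (invmx A) i); rewrite mul1n.
Qed.

(* (A . f)(u, v) = f(A^-1 (u, v)^T) *)
Definition form_act n (A : 'M[C]_2) (f : 'V[C]_n) : 'V[C]_n :=
  DHomog (form_act_subproof A f).

Lemma form_act_is_linear n A : linear (@form_act n A).
Proof. by move=> c f g; apply: val_inj; rewrite /= linearP. Qed.

HB.instance Definition _ n A :=
  GRing.isLinear.Build C 'V[C]_n 'V[C]_n _ (form_act A)
    (@form_act_is_linear n A).

Lemma form_act1 n (f : 'V[C]_n) : form_act 1%:M f = f.
Proof.
apply: val_inj => /=; rewrite invmx1 -[RHS]comp_mpoly_id.
congr (_ \mPo _); apply: eq_from_tnth => i; rewrite !tnth_mktuple.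
by rewrite (bigD1 i) //= big1 => [|j /negPf ji]; rewrite mxE ?eqxx ?scale1r
  ?addr0 // eq_sym ji scale0r.
Qed.

Lemma form_actM n A B (f : 'V[C]_n) : A \in unitmx -> B \in unitmx ->
  form_act (A *m B) f = form_act A (form_act B f).
Proof.
move=> uA uB; apply: val_inj => /=.
have -> : invmx (A *m B) = invmx B *m invmx A.
  have uAB : A *m B \in unitmx by rewrite unitmx_mul uA.
  apply: (can_inj (mulKmx uAB)); rewrite mulmxV //.
  by rewrite mulmxA -(mulmxA A) mulmxV // mulmx1 mulmxV.
rewrite [LHS]comp_mpolyE [X in _ = X \mPo _]comp_mpolyE linear_sum; apply: eq_bigr => m _ /=.
rewrite linearZ /= rmorph_prod; congr (_ *: _); apply: eq_bigr => i _.
rewrite rmorphXn /=; congr (_ ^+ _).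
rewrite !tnth_mktuple linear_sum /=.
under [RHS]eq_bigr do
  rewrite linearZ /= comp_mpolyXU -tnth_nth tnth_mktuple scaler_sumr.
rewrite exchange_big; apply: eq_bigr => j _ /=.
by rewrite mxE scaler_suml; apply: eq_bigr => k _; rewrite scalerA.
Qed.

Lemma form_deriv_subproof n (i : 'I_2) (f : 'V[C]_n) :
  (f : {mpoly C[2]})^`M(i) \is n.-1.-homog.
Proof.
apply/dhomogP => m; rewrite mcoeff_msupp mcoeff_mderiv => nz.
have m_f : (m + U_(i))%MM \in msupp (f : {mpoly C[2]}).
  by rewrite mcoeff_msupp; apply: contraNneq nz => ->; rewrite mul0rn.
have /dhomogP/(_ _ m_f) /= <- := dhomog_is_dhomog f.
by rewrite mdegD mdeg1 addn1.
Qed.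

Definition form_deriv n (i : 'I_2) (f : 'V[C]_n) : 'V[C]_n.-1 :=
  DHomog (form_deriv_subproof i f).

Definition form_mul n m (f : 'V[C]_n) (g : 'V[C]_m) : 'V[C]_(n + m) :=
  DHomog (dhomogM (dhomog_is_dhomog f) (dhomog_is_dhomog g)).

Definition is_invariant n (G : {fset 'M[C]_2}) (f : 'V[C]_n) : Prop :=
  f != 0 /\ stable G (@form_act n) <[f]>%VS.

(* V_n (x) C^2 as pairs, (p, q) standing for p (x) e_1 + q (x) e_2. *)
Definition tens n (p : 'V[C]_n) (x : 'cV[C]_2) : 'V[C]_n * 'V[C]_n :=
  (x 0 0 *: p, x 1 0 *: p).

Definition e1 : 'cV[C]_2 := delta_mx 0 0.
Definition e2 : 'cV[C]_2 := delta_mx 1 0.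

(* The row (A . p, A . q) times the matrix A^T. *)
Definition tens_act n (A : 'M[C]_2) (t : 'V[C]_n * 'V[C]_n) :
    'V[C]_n * 'V[C]_n :=
  (A^T 0 0 *: form_act A t.1 + A^T 1 0 *: form_act A t.2,
   A^T 0 1 *: form_act A t.1 + A^T 1 1 *: form_act A t.2).

Lemma tens_act_tens n A (p : 'V[C]_n) (x : 'cV[C]_2) :
  tens_act A (tens p x) = tens (form_act A p) (A *m x).
Proof.
rewrite /tens_act /tens /= !linearZ /= !scalerA -!scalerDl !mxE.
have -> : (1 : 'I_2) = lift ord0 ord0 by apply: val_inj.
rewrite !big_ord_recl !big_ord0 !addr0.
by congr ((_ + _) *: _, (_ + _) *: _); rewrite mulrC.
Qed.

End BinaryForms.

Arguments form_var {C} i.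
Arguments form_u {C}.
Arguments form_v {C}.
Arguments form_act {C n} A f.
Arguments e1 {C}.
Arguments e2 {C}.
Arguments tens_act {C n} A t.

(* Main.v *)
Require Import Defs.
From HB Require Import structures.
From mathcomp Require Import all_boot all_order all_algebra.
From mathcomp Require Import finmap reals complex mpoly spectral.

(** Let c be the character of f.  Both parts rest on one variant of Schur's
lemma.  Call a linear map phi twisted equivariant when A.phi(w) =
c(A) phi(A.w) for A in G, with c(A) invertible.  The kernel of phi and the
preimages under phi of stable subspaces are stable, so a twisted equivariant
map that does not vanish on an irreducible U is injective on U, its image is
irreducible ([twisted_image_irreducible]), and computing the trace in the image
of a basis of U shows that the image has character c chi_U
([twisted_image_character]).

Part (2) is the case of the multiplication by f: it is twisted equivariant
because A.(fg) = (A.f)(A.g) = c(A) f (A.g), and nonzero because polynomials form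
an integral domain.

Part (1) is the case of the map V_1 -> V_(n-1) sending u to -df/dv and v to
df/du.  Differentiating A.f = c(A) f by the chain rule expresses c(A) grad f in
terms of A.grad f through the matrix A^-1; since det A = 1, Cramer's rule
inverts this system, and the inverse says exactly that the map is twisted equivariant
([symplectic_gradient_act]).  It is nonzero because in characteristic 0 a form
of positive degree with zero gradient is zero ([form_gradient_eq0]).

For the lines in V_d (x) C^2, let phi : V_1 -> V_d be linear with
A.phi(l) = c phi(A.l).  Then A multiplies (phi(u), phi(v)) by c
([tens_act_equivariant]): the pair (u, v) is fixed because the substitution by
A^-1 is undone by the matrix A acting on C^2.  The map of part (1) gives the line
of -df/dv (x) e_1 + df/du (x) e_2, and the identity gives that of
u (x) e_1 + v (x) e_2. *)

Set Implicit Arguments.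
Unset Strict Implicit.
Unset Printing Implicit Defensive.

Import GRing.Theory Num.Theory.
Local Open Scope ring_scope.

(** * Characters and twisted equivariant maps *)

Section TwistedSchur.
Variable C : fieldType.

(** A trace may be computed in any basis, whereas [character] fixes [vbasis]:
expand each basis in the other and use that the two changes of coordinates are
inverse to each other. *)
Lemma character_basisE (V : vectType C) (act : 'M[C]_2 -> V -> V)
    (U : {vspace V}) (A : 'M[C]_2) (n : nat) (X : n.-tuple V) :
  linear (act A) -> basis_of U X -> (forall w, w \in U -> act A w \in U) ->
  character act U A = \sum_i coord X i (act A X`_i).
Proof.
move=> lin_a bX aU; set Y := vbasis U; have bY : basis_of U Y := vbasisP U.
pose a : {linear V -> V} :=
  HB.pack (act A) (GRing.isLinear.Build C V V _ (act A) lin_a).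
have YU (i : 'I_(\dim U)) : Y`_i \in U.
  by apply/vbasis_mem/mem_nth; rewrite size_tuple.
have XU (i : 'I_n) : X`_i \in U.
  by apply: (basis_mem bX); apply: mem_nth; rewrite size_tuple.
have coordXY i y : y \in U ->
    coord X i y = \sum_l coord Y l y * coord X i Y`_l.
  move=> yU; rewrite {1}(coord_basis bY yU) linear_sum.
  by apply: eq_bigr => l _; rewrite linearZ.
have aX (i : 'I_n) : act A X`_i = \sum_k coord Y k X`_i *: act A Y`_k.
  rewrite -[act A]/(a : V -> V) {1}(coord_basis bY (XU i)) linear_sum.
  by apply: eq_bigr => k _; rewrite linearZ.
have dualXY (k l : 'I_(\dim U)) :
    \sum_i coord X i Y`_l * coord Y k X`_i = (l == k)%:R.
  rewrite -(coord_free _ _ (basis_free bY)) {2}(coord_basis bX (YU l)).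
  rewrite linear_sum.
  by apply: eq_bigr => i _; rewrite linearZ.
rewrite /character /mxtrace.
under [RHS]eq_bigr => i _ do rewrite coordXY ?aU // aX.
rewrite exchange_big /=; apply: eq_bigr => l _; rewrite mxE.
under [RHS]eq_bigr => i _ do rewrite linear_sum mulr_suml.
rewrite exchange_big /= (bigD1 l) //=.
under eq_bigr => i _ do
  rewrite linearZ /= mulrAC [_ * coord X i _]mulrC.
rewrite -mulr_suml dualXY eqxx mul1r big1 ?addr0 // => k kl.
under eq_bigr => i _ do
  rewrite linearZ /= mulrAC [_ * coord X i _]mulrC.
by rewrite -mulr_suml dualXY eq_sym (negPf kl) mul0r.
Qed.

Section Eigenline.
Variables (V : vectType C) (G : {fset 'M[C]_2}) (act : 'M[C]_2 -> V -> V).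
Variables (w : V) (c : 'M[C]_2 -> C).
Hypothesis lin_act : forall A, linear (act A).
Hypothesis w_neq0 : w != 0.
Hypothesis act_w : {in G, forall A, act A w = c A *: w}.

Lemma eigenline_stable A : A \in G ->
  forall x, x \in <[w]>%VS -> act A x \in <[w]>%VS.
Proof.
move=> GA x /vlineP[k ->].
pose a : {linear V -> V} :=
  HB.pack (act A) (GRing.isLinear.Build C V V _ (act A) (lin_act A)).
rewrite -[act A]/(a : V -> V) linearZ /= act_w //.
by apply/memvZ/memvZ/memv_line.
Qed.

Lemma eigenline_one_dim : one_dim_invariant_subspace G act <[w]>%VS.
Proof.
split; last by rewrite dim_vline w_neq0.
by move=> A x GA; apply: eigenline_stable.
Qed.

Lemma eigenline_character A : A \in G -> character act <[w]>%VS A = c A.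
Proof.
move=> GA; have bw : basis_of <[w]> [tuple w] by apply: seq1_basis.
rewrite (character_basisE (lin_act A) bw (eigenline_stable GA)).
rewrite big_ord_recl big_ord0 addr0 /= act_w // linearZ /=.
by have /= -> := coord_free ord0 ord0 (basis_free bw); rewrite mulr1.
Qed.

End Eigenline.

(** Equivalently, phi intertwines c (x) V with W, for c a scalar function on G. *)
Definition twisted_equivariant (V W : vectType C) (G : {fset 'M[C]_2})
    (actV : 'M[C]_2 -> V -> V) (actW : 'M[C]_2 -> W -> W)
    (c : 'M[C]_2 -> C) (phi : 'Hom(V, W)) : Prop :=
  forall A w, A \in G -> actW A (phi w) = c A *: phi (actV A w).

Section Image.
Variables (V W : vectType C) (G : {fset 'M[C]_2}).
Variables (actV : 'M[C]_2 -> V -> V) (actW : 'M[C]_2 -> W -> W).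
Variables (c : 'M[C]_2 -> C) (phi : 'Hom(V, W)) (U : {vspace V}).
Hypothesis lin_actW : forall A, linear (actW A).
Hypothesis c_neq0 : {in G, forall A, c A != 0}.
Hypothesis phi_eq : twisted_equivariant G actV actW c phi.
Hypothesis irrU : irreducible_rep G actV U.
Hypothesis phiU_neq0 : (phi @: U != 0)%VS.

(** The half of Schur's lemma that survives the twist: scaling by c(A) does not
change which vectors vanish, so the kernel of phi in U is stable. *)
Lemma twisted_kernel : (U :&: lker phi = 0)%VS.
Proof.
have [stU _ minU] := irrU.
case: (minU (U :&: lker phi)%VS) => // [|A w GA|kerU]; first exact: capvSl.
- case/memv_capP=> wU /[!memv_ker]/eqP phiw0; apply/memv_capP; split.
    exact: stU.
  have := phi_eq w GA; rewrite phiw0.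
  pose a : {linear W -> W} :=
    HB.pack (actW A) (GRing.isLinear.Build C W W _ (actW A) (lin_actW A)).
  rewrite -[actW A]/(a : W -> W) linear0 => /esym/eqP.
  by rewrite scaler_eq0 (negPf (c_neq0 GA)) memv_ker.
- case/negP: phiU_neq0; rewrite -subv0; apply/subvP => _ /memv_imgP[w wU ->].
  by move: wU; rewrite -kerU => /memv_capP[_]; rewrite memv_ker memv0.
Qed.

Lemma twisted_image_stable : stable G actW (phi @: U)%VS.
Proof.
have [stU _ _] := irrU.
move=> A _ GA /memv_imgP[w wU ->]; rewrite (phi_eq w GA).
by apply/memvZ/memv_img/stU.
Qed.

(** Stable subspaces of the image pull back to stable subspaces of U; here c(A)
has to be divided out. *)
Lemma twisted_image_irreducible : irreducible_rep G actW (phi @: U)%VS.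
Proof.
have [stU _ minU] := irrU.
split=> // [|W' W'phiU stW']; first exact: twisted_image_stable.
have W'E : (phi @: (U :&: phi @^-1: W') = W')%VS.
  apply/eqP; rewrite eqEsubv; apply/andP; split; apply/subvP=> x.
    by case/memv_imgP=> w /memv_capP[_ +] ->; rewrite memv_preim.
  move=> xW'; have /memv_imgP[w wU xE] := subvP W'phiU x xW'.
  by rewrite xE memv_img // memv_cap wU -memv_preim -xE.
case: (minU (U :&: phi @^-1: W')%VS) => [|A w GA|UW'|UW'].
- exact: capvSl.
- rewrite !memv_cap -!memv_preim => /andP[wU phiw]; rewrite stU //=.
  have := stW' _ _ GA phiw; rewrite (phi_eq w GA) => /(memvZ (c A)^-1).
  by rewrite scalerA mulVf ?c_neq0 // scale1r.
- by left; rewrite -W'E UW' limg0.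
- by right; rewrite -W'E UW'.
Qed.

(** In the basis phi(b_i) of the image, the matrix of A is c(A) times the matrix
of A in the basis b_i of U. *)
Lemma twisted_image_character A : A \in G ->
  character actW (phi @: U)%VS A = c A * character actV U A.
Proof.
have [stU _ _] := irrU.
move=> GA; have bphi : basis_of (phi @: U) (map_tuple phi (vbasis U)).
  by rewrite limg_basis_of ?vbasisP ?twisted_kernel.
have bU := vbasisP U.
rewrite (character_basisE (lin_actW A) bphi); last first.
  by move=> w; apply: twisted_image_stable.
rewrite /character /mxtrace mulr_sumr; apply: eq_bigr => i _; rewrite mxE.
rewrite (nth_map 0) ?size_tuple // (phi_eq _ GA) linearZ /=; congr (_ * _).
have Ui : actV A (vbasis U)`_i \in U.
  by apply: stU => //; apply/vbasis_mem/mem_nth; rewrite size_tuple.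
rewrite {1}(coord_basis bU Ui) !linear_sum (bigD1 i) //=.
have coord_phi (k : 'I_(\dim U)) :
    coord (map_tuple phi (vbasis U)) i (phi (vbasis U)`_k) = (k == i)%:R.
  by rewrite -(coord_free _ _ (basis_free bphi)) /= (nth_map 0) ?size_tuple.
rewrite !linearZ /= coord_phi eqxx mulr1 big1 ?addr0 // => k ki.
by rewrite !linearZ /= coord_phi (negPf ki) mulr0.
Qed.

End Image.
End TwistedSchur.

(** * Polynomials, derivatives and substitutions *)

Lemma mnm1_eq n (i j : 'I_n) : (U_(i) == U_(j) :> 'X_{1..n})%MM = (i == j).
Proof.
by apply/eqP/eqP => [/mnmP/(_ j)|->//]; rewrite !mnm1E eqxx; case: eqP.
Qed.

(** Chain rule.  Both sides are derivations along the ring morphism of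
substitution, so it is enough to compare them on the variables. *)
Lemma mderiv_comp_mpoly (C : fieldType) (n k : nat) (i : 'I_k)
    (p : {mpoly C[n]}) (L : n.-tuple {mpoly C[k]}) :
  (p \mPo L)^`M(i) =
  \sum_j (p^`M(j) \mPo L) * (tnth L j)^`M(i).
Proof.
pose chain (p : {mpoly C[n]}) := (p \mPo L)^`M(i) =
  \sum_j (p^`M(j) \mPo L) * (tnth L j)^`M(i).
have chain0 : chain 0.
  by rewrite /chain !raddf0 big1 // => j _; rewrite !raddf0 mul0r.
have chainD q r : chain q -> chain r -> chain (q + r).
  rewrite /chain !raddfD /= => -> ->; rewrite -big_split /=.
  by apply: eq_bigr => j _; rewrite !raddfD /= mulrDl.
have chainZ c q : chain q -> chain (c *: q).
  rewrite /chain !linearZ /= => ->; rewrite scaler_sumr.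
  by apply: eq_bigr => j _; rewrite !linearZ /= scalerAl.
have chain1 : chain 1.
  rewrite /chain rmorph1 -mpolyC1 mderivC big1 // => j _.
  by rewrite -mpolyC1 mderivC raddf0 mul0r.
have chainM q r : chain q -> chain r -> chain (q * r).
  rewrite /chain rmorphM !mderivM => -> ->.
  rewrite mulr_suml mulr_sumr -big_split /=; apply: eq_bigr => j _.
  by rewrite mderivM raddfD /= !rmorphM /= mulrDl mulrAC mulrA.
have chainX j : chain 'X_j.
  rewrite /chain comp_mpolyXU -tnth_nth (bigD1 j) //= big1 => [|l lj].
    rewrite mderivX mnm1E eqxx addr0 scale1r.
    by rewrite -{1}[U_(j)%MM]add0m addmK mpolyX0 rmorph1 mul1r.
  by rewrite mderivX mnm1E eq_sym (negPf lj) scale0r raddf0 mul0r.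
elim/mpolyind: p => [|c m p _ _ chain_p]; first exact: chain0.
apply/chainD/chain_p/chainZ; rewrite mpolyXE_id.
apply: (big_ind chain) => // j _.
by elim: (m j) => [|d IH]; rewrite ?expr0 // exprS; apply: chainM.
Qed.

Lemma big_ord2 (V : zmodType) (F : 'I_2 -> V) : \sum_i F i = F 0 + F 1.
Proof. by rewrite big_ord_recl big_ord1; congr (_ + F _); apply: val_inj. Qed.

Lemma ord2_ind (P : 'I_2 -> Prop) : P 0 -> P 1 -> forall i, P i.
Proof.
by move=> P0 P1 [[|[|//]] lt_i]; [move: P0 | move: P1]; congr P; apply: val_inj.
Qed.

(** * Binary forms under linear substitutions *)

Section Forms.
Variable C : fieldType.

Lemma form_act_var (A : 'M[C]_2) (i : 'I_2) :
  form_act A (form_var i) =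
  invmx A i 0 *: form_u + invmx A i 1 *: form_v.
Proof.
apply: val_inj; rewrite /= comp_mpolyXU -tnth_nth tnth_mktuple.
by rewrite big_ord2.
Qed.

Lemma linear_formE (l : 'V[C]_1) :
  l = (l : {mpoly C[2]})@_U_(0) *: form_u + (l : {mpoly C[2]})@_U_(1) *: form_v.
Proof.
apply: val_inj; apply/mpolyP => m; rewrite /= mcoeffD !mcoeffZ !mcoeffX.
have [m1|/eqP m1] := eqVneq (mdeg m) 1%N; last first.
  rewrite (dhomog_nemf_coeff (dhomog_is_dhomog l)); last exact/eqP.
  case: eqP => [mE|_]; first by case: m1; rewrite -mE mdeg1.
  case: eqP => [mE|_]; first by case: m1; rewrite -mE mdeg1.
  by rewrite !mulr0 addr0.
have /mdeg1P[i /eqP->] : mdeg m == 1%N by apply/eqP.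
rewrite !mnm1_eq; elim/ord2_ind: i.
  by rewrite mulr1 mulr0 addr0.
by rewrite mulr1 mulr0 add0r.
Qed.

Lemma span_form_uv : <<[:: form_u; form_v]>>%VS = fullv :> {vspace 'V[C]_1}.
Proof.
apply/eqP; rewrite eqEsubv subvf; apply/subvP => l _; rewrite (linear_formE l).
by apply/rpredD; apply/memvZ/memv_span; rewrite !inE eqxx ?orbT.
Qed.

(** The chain rule: the gradient transforms by the transpose of A^-1. *)
Lemma form_deriv_act n (A : 'M[C]_2) (f : 'V[C]_n) (i : 'I_2) :
  form_deriv i (form_act A f) =
  invmx A 0 i *: form_act A (form_deriv 0 f) +
  invmx A 1 i *: form_act A (form_deriv 1 f).
Proof.
have dL (j : 'I_2) : (tnth (lin_subst (invmx A)) j)^`M(i) = (invmx A j i)%:MP.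
  rewrite tnth_mktuple linear_sum (bigD1 i) //= big1 => [|l li].
    rewrite linearZ /= mderivX mnm1E eqxx scale1r.
    by rewrite -{1}[U_(i)%MM]add0m addmK mpolyX0 addr0 alg_mpolyC.
  by rewrite linearZ /= mderivX mnm1E (negPf li) scale0r scaler0.
apply: val_inj; rewrite /= mderiv_comp_mpoly big_ord2 !dL.
by rewrite ![_ * _%:MP]mulrC !mul_mpolyC.
Qed.

Lemma form_mul_is_linear n m (f : 'V[C]_n) : linear (@form_mul C n m f).
Proof. by move=> c g h; apply: val_inj; rewrite /= mulrDr scalerAr. Qed.

HB.instance Definition _ n m (f : 'V[C]_n) :=
  GRing.isLinear.Build C 'V[C]_m 'V[C]_(n + m) _ (form_mul f)
    (@form_mul_is_linear n m f).

Lemma form_mul_act n m (A : 'M[C]_2) (f : 'V[C]_n) (g : 'V[C]_m) :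
  form_act A (form_mul f g) = form_mul (form_act A f) (form_act A g).
Proof. by apply: val_inj; rewrite /= rmorphM. Qed.

Lemma tens_act_is_linear n A : linear (@tens_act C n A).
Proof.
move=> c s t; rewrite /tens_act /= !linearP /=.
congr (_, _); rewrite /= !scalerDr !scalerA ![c * _]mulrC addrACA //.
Qed.

(** The linear map V_1 -> V_(n-1) with u |-> -df/dv and v |-> df/du; the
coefficients of u and v in l are its coordinates.  This rotation of the gradient
is what turns the dual action on derivatives into the action on V_1, for matrices
of determinant 1. *)
Definition symplectic_gradient n (f : 'V[C]_n) (l : 'V[C]_1) : 'V[C]_n.-1 :=
  (l : {mpoly C[2]})@_U_(0) *: (- form_deriv 1 f) +
  (l : {mpoly C[2]})@_U_(1) *: form_deriv 0 f.

Lemma symplectic_gradientD n (f : 'V[C]_n) (a b : C) (l l' : 'V[C]_1) :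
  symplectic_gradient f (a *: l + b *: l') =
  a *: symplectic_gradient f l + b *: symplectic_gradient f l'.
Proof.
rewrite /symplectic_gradient /= !mcoeffD !mcoeffZ !scalerDl !scalerDr.
by rewrite !scalerA addrACA.
Qed.

Lemma symplectic_gradient_is_linear n (f : 'V[C]_n) :
  linear (symplectic_gradient f).
Proof.
by move=> c l l'; have := symplectic_gradientD f c 1 l l'; rewrite !scale1r.
Qed.

HB.instance Definition _ n (f : 'V[C]_n) :=
  GRing.isLinear.Build C 'V[C]_1 'V[C]_n.-1 _ (symplectic_gradient f)
    (@symplectic_gradient_is_linear n f).

Lemma symplectic_gradient_u n (f : 'V[C]_n) :
  symplectic_gradient f form_u = - form_deriv 1 f.
Proof.
by rewrite /symplectic_gradient /= !mcoeffX eqxx mnm1_eq scale1r scale0r addr0.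
Qed.

Lemma symplectic_gradient_v n (f : 'V[C]_n) :
  symplectic_gradient f form_v = form_deriv 0 f.
Proof.
by rewrite /symplectic_gradient /= !mcoeffX eqxx mnm1_eq scale1r scale0r add0r.
Qed.

Lemma tens_basis n (p q : 'V[C]_n) : tens p e1 + tens q e2 = (p, q).
Proof.
by congr (_, _); rewrite /= !mxE /= scale1r scale0r ?addr0 ?add0r.
Qed.

Lemma det_mx2 (B : 'M[C]_2) : \det B = B 0 0 * B 1 1 - B 0 1 * B 1 0.
Proof.
rewrite (expand_det_row _ 0) big_ord2 /cofactor !det_mx11 !mxE /=.
rewrite expr0 expr1 mul1r mulN1r mulrN.
by congr (_ * B _ _ - _ * B _ _); apply: val_inj.
Qed.

End Forms.

(** * Equivariance of the gradient and of the tensors *)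

(** Cramer's rule with unknown vectors p and q. *)
Lemma cramer2 (C : fieldType) (V : lmodType C) (a b c d : C) (p q x y : V) :
  a * d - b * c = 1 -> x = a *: p + c *: q -> y = b *: p + d *: q ->
  p = d *: x - c *: y /\ q = a *: y - b *: x.
Proof.
move=> det1 -> ->; rewrite !scalerDr !scalerA !opprD; split.
  rewrite [d * c]mulrC addrACA subrr addr0 -scalerBl.
  by rewrite [d * a]mulrC [c * b]mulrC det1 scale1r.
by rewrite [a * b]mulrC addrACA subrr add0r -scalerBl det1 scale1r.
Qed.

Section Equivariance.
Variable C : fieldType.

(** The linear forms transform by A^-1, so the combinations with coefficients in
the rows of A recover u and v. *)
Lemma form_act_var_dual (A : 'M[C]_2) (i : 'I_2) : A \in unitmx ->
  A i 0 *: form_act A form_u + A i 1 *: form_act A form_v = form_var i.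
Proof.
move=> uA; have AB j : A i 0 * invmx A 0 j + A i 1 * invmx A 1 j = (i == j)%:R.
  by have /matrixP/(_ i j) := mulmxV uA; rewrite !mxE big_ord2.
rewrite /form_u /form_v !form_act_var !scalerDr !scalerA addrACA -!scalerDl !AB.
elim/ord2_ind: i {AB}; first by rewrite /= scale1r scale0r addr0.
by rewrite /= scale1r scale0r add0r.
Qed.

(** With B = A^-1, the chain rule gives c f_u = B_00 A.f_u + B_10 A.f_v and
c f_v = B_01 A.f_u + B_11 A.f_v.  Solving for A.f_u and A.f_v yields
A.(-f_v) = c (B_00 (-f_v) + B_01 f_u) and A.f_u = c (B_10 (-f_v) + B_11 f_u),
which are the coefficients of A.u and A.v. *)
Lemma symplectic_gradient_act n (A : 'M[C]_2) (f : 'V[C]_n) (c : C)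
    (l : 'V[C]_1) :
  \det A = 1 -> form_act A f = c *: f ->
  form_act A (symplectic_gradient f l) =
  c *: symplectic_gradient f (form_act A l).
Proof.
move=> detA fA; have detB : \det (invmx A) = 1 by rewrite det_inv detA invr1.
have derivA (i : 'I_2) : c *: form_deriv i f =
    invmx A 0 i *: form_act A (form_deriv 0 f) +
    invmx A 1 i *: form_act A (form_deriv 1 f).
  by rewrite -form_deriv_act fA; apply: val_inj; rewrite /= linearZ.
have [fuA fvA] :=
  cramer2 (etrans (esym (det_mx2 _)) detB) (derivA 0) (derivA 1).
have act_var i : form_act A (symplectic_gradient f (form_var i)) =
    c *: symplectic_gradient f (form_act A (form_var i)).
  rewrite form_act_var symplectic_gradientD.
  rewrite symplectic_gradient_u symplectic_gradient_v.
  elim/ord2_ind: i.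
    rewrite -/form_u symplectic_gradient_u linearN /= fvA opprB addrC.
    by rewrite scalerDr !scalerN !scalerA ![c * _]mulrC addrC.
  rewrite -/form_v symplectic_gradient_v fuA addrC.
  by rewrite scalerDr !scalerN !scalerA ![c * _]mulrC.
have actD d (x y : C) (p q : 'V[C]_d) :
    form_act A (x *: p + y *: q) = x *: form_act A p + y *: form_act A q.
  by rewrite linearD !linearZ.
rewrite (linear_formE l) symplectic_gradientD actD [in RHS]actD.
rewrite symplectic_gradientD /form_u /form_v !act_var.
by rewrite [in RHS]scalerDr !scalerA ![c * _]mulrC.
Qed.

(** Up to c, the matrix part of the action gives the image under phi of the
invariant pair of [form_act_var_dual]. *)
Lemma tens_act_equivariant n (A : 'M[C]_2) (c : C)
    (phi : 'Hom('V[C]_1, 'V[C]_n)) :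
  A \in unitmx ->
  (forall l, form_act A (phi l) = c *: phi (form_act A l)) ->
  tens_act A (phi form_u, phi form_v) = c *: (phi form_u, phi form_v).
Proof.
move=> uA phiA; rewrite /tens_act /= !phiA !mxE.
have comp i : A i 0 *: (c *: phi (form_act A form_u)) +
    A i 1 *: (c *: phi (form_act A form_v)) = c *: phi (form_var i).
  rewrite -(form_act_var_dual i uA) linearD !linearZ /= scalerDr !scalerA.
  by rewrite ![c * _]mulrC.
by rewrite !comp.
Qed.

(** A acts invertibly, so it cannot send a nonzero form to 0. *)
Lemma eigenform_neq0 n (A : 'M[C]_2) (f : 'V[C]_n) (c : C) :
  A \in unitmx -> f != 0 -> form_act A f = c *: f -> c != 0.
Proof.
move=> uA f0 fA; apply: contra_neq f0 => c0.
have uA' : invmx A \in unitmx by rewrite unitmx_inv.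
by rewrite -(form_act1 f) -(mulVmx uA) form_actM // fA c0 scale0r linear0.
Qed.

Lemma invariant_eigenform n G (f : 'V[C]_n) : is_invariant G f ->
  {in G, forall A,
    form_act A f = character form_act <[f]>%VS A *: f}.
Proof.
move=> [f0 stf] A GA; have /vlineP[c fA] := stf _ _ GA (memv_line f).
pose c' A := coord [tuple f] 0 (form_act A f).
have c'E : {in G, forall A, form_act A f = c' A *: f}.
  move=> B GB; have Bf := stf _ _ GB (memv_line f).
  have bf : basis_of <[f]> [tuple f] by apply: seq1_basis.
  rewrite {1}(coord_basis bf Bf) big_ord_recl big_ord0 addr0 /=.
  by congr (coord _ _ _ *: _); apply: val_inj.
by rewrite (eigenline_character (@form_act_is_linear C n) f0 c'E) // -c'E.
Qed.

End Equivariance.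

(** Every monomial of positive degree is divisible by some variable x_i, and in
characteristic 0 its coefficient can be read off the derivative along x_i. *)
Lemma form_gradient_eq0 (C : numFieldType) n (f : 'V[C]_n) :
  (0 < n)%N -> (forall i, form_deriv i f = 0) -> f = 0.
Proof.
case: n f => // n f _ df; apply: val_inj; apply/mpolyP => m; rewrite /= mcoeff0.
have [md|md] := eqVneq (mdeg m) n.+1; last first.
  exact: dhomog_nemf_coeff (dhomog_is_dhomog f) md.
have [i mi] : exists i, (0 < m i)%N.
  apply/existsP; apply: contra_eqT md => /existsPn m0.
  by rewrite mdegE big1 // => i _; apply/eqP; rewrite -leqn0 leqNgt m0.
have /(congr1 (fun p : 'V[C]_n => (p : {mpoly C[2]})@_(m - U_(i)))) := df i.
rewrite /= mcoeff0 mcoeff_mderiv submK; last first.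
  by apply/mnm_lepP => j; rewrite mnm1E; case: eqP => // <-.
by move/eqP; rewrite -mulr_natr mulf_eq0 pnatr_eq0 orbF => /eqP.
Qed.


Theorem proposition2p2 (R : realType) (G : {fset 'M[R[i]]_2})
    (n m k : nat) (f : 'V[R[i]]_n) (g : k.-tuple 'V[R[i]]_m) :
  let V1 : {vspace 'V[R[i]]_1} := fullv in
  let chi_V1 := character form_act V1 in
  let chi_f := character form_act <[f]>%VS in
  let chi' := character form_act <<g>>%VS in
  let f_u := form_deriv 0 f in
  let f_v := form_deriv 1 f in
  let grad := <<[:: f_u; f_v]>>%VS in
  let line := <[tens (- f_v) e1 + tens f_u e2]>%VS in
  let line1 := <[tens form_u e1 + tens form_v e2]>%VS in
  let fg := <<[seq form_mul f gi | gi <- g]>>%VS in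
  finite_subgroup_SU2 G ->
  irreducible_rep G form_act V1 ->
  (1 <= n)%N ->
  is_invariant G f ->
  irreducible_rep G form_act <<g>>%VS ->
  ((irreducible_rep G form_act grad /\
    {in G, forall A,
       character form_act grad A = chi_f A * chi_V1 A}) /\
   (one_dim_invariant_subspace G tens_act line /\
    {in G, forall A, character tens_act line A = chi_f A}) /\
   one_dim_invariant_subspace G tens_act line1) /\
  (irreducible_rep G form_act fg /\
   {in G, forall A,
      character form_act fg A = chi_f A * chi' A}).
Proof.
move=> V1 chi_V1 chi_f chi' f_u f_v grad line line1 fg.
move=> [_ _ _ unitG] irrV1 n_gt0 invf irrg.
have [f0 stf] := invf.
have fE : {in G, forall A, form_act A f = chi_f A *: f}.
  exact: invariant_eigenform.
have detG A : A \in G -> \det A = 1 by case/unitG.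
have GU A : A \in G -> A \in unitmx.
  by move/detG; rewrite unitmxE => ->; apply: unitr1.
have chi_f0 : {in G, forall A, chi_f A != 0}.
  by move=> A GA; apply: eigenform_neq0 (GU A GA) f0 (fE A GA).
have grad_neq0 : (f_u != 0) || (f_v != 0).
  rewrite -negb_and; apply: contra f0 => /andP[/eqP fu0 /eqP fv0].
  by apply/eqP/form_gradient_eq0 => //; apply: ord2_ind.
pose phi := linfun (symplectic_gradient f).
have phi_eq : twisted_equivariant G form_act form_act chi_f phi.
  move=> A l GA; rewrite !lfunE.
  exact: symplectic_gradient_act (detG A GA) (fE A GA).
have phiu : phi form_u = - f_v by rewrite lfunE /= symplectic_gradient_u.
have phiv : phi form_v = f_u by rewrite lfunE /= symplectic_gradient_v.
have gradE : (phi @: V1)%VS = grad.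
  rewrite /V1 -span_form_uv limg_span /= phiu phiv /grad !span_cons span_nil.
  rewrite !addv0 addvC; congr (_ + _)%VS; apply/eqP.
  rewrite eqEsubv -!memvE memvN memv_line.
  by rewrite -[X in X \in _]opprK memvN memv_line.
have grad0 : (phi @: V1 != 0)%VS.
  rewrite gradE; apply: contraTneq grad_neq0 => grad0; rewrite negb_or !negbK.
  by rewrite -!memv0 -grad0 !memv_span // !inE eqxx ?orbT.
pose psi : 'Hom('V[R[i]]_m, 'V[R[i]]_(n + m)) := linfun (form_mul f).
have psi_eq : twisted_equivariant G form_act form_act chi_f psi.
  move=> A l GA; rewrite !lfunE /= form_mul_act fE //.
  by apply: val_inj; rewrite /= scalerAl.
have fgE : (psi @: <<g>>)%VS = fg.
  by rewrite limg_span; congr <<_>>%VS; apply: eq_map => x; rewrite lfunE.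
have psi0 : (psi @: <<g>> != 0)%VS.
  have [_ g0 _] := irrg; apply: contra g0 => /eqP psig0.
  rewrite -subv0; apply/subvP => x xg.
  have : psi x \in (psi @: <<g>>)%VS by apply: memv_img.
  rewrite psig0 !memv0 lfunE /= => /eqP/(congr1 val)/eqP.
  rewrite /= mulf_eq0 => /orP[/eqP fz|/eqP xz]; last exact/eqP/val_inj.
  by case/eqP: f0; apply: val_inj.
have lin_act d := @form_act_is_linear R[i] d.
split; last first.
  rewrite -fgE; split.
    exact: (twisted_image_irreducible chi_f0 psi_eq irrg psi0).
  move=> A GA.
  exact: (twisted_image_character (@lin_act _) chi_f0 psi_eq irrg psi0).
split.
  rewrite -gradE; split.
    exact: (twisted_image_irreducible chi_f0 phi_eq irrV1 grad0).
  move=> A GA.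
  exact: (twisted_image_character (@lin_act _) chi_f0 phi_eq irrV1 grad0).
have lineE : {in G, forall A,
    tens_act A (- f_v, f_u) = chi_f A *: (- f_v, f_u)}.
  move=> A GA; rewrite -phiu -phiv.
  apply: tens_act_equivariant (GU A GA) _ => l.
  exact: phi_eq.
have line_neq0 : (- f_v, f_u) != 0.
  apply: contraTneq grad_neq0 => t0; rewrite negb_or !negbK.
  have /= fu0 := congr1 snd t0; have /= fv0 := congr1 fst t0.
  by rewrite fu0 -(oppr_eq0 f_v) fv0 !eqxx.
have line1E : {in G, forall A,
    tens_act A (form_u, form_v) =
    1 *: (form_u, form_v) :> 'V[R[i]]_1 * 'V[R[i]]_1}.
  move=> A GA; have := @tens_act_equivariant _ _ A 1 \1%VF (GU A GA).
  by rewrite !id_lfunE; apply=> l; rewrite !id_lfunE scale1r.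
have line1_neq0 : (form_u, form_v) != 0 :> 'V[R[i]]_1 * 'V[R[i]]_1.
  pose coef_u (l : 'V[R[i]]_1) := (l : {mpoly R[i][2]})@_U_(0).
  apply/eqP => /(congr1 fst) /(congr1 coef_u) /eqP.
  by rewrite /coef_u /= mcoeffX eqxx mcoeff0 oner_eq0.
rewrite /line /line1 !tens_basis.
split; first split.
- exact: eigenline_one_dim (@tens_act_is_linear _ _) line_neq0 lineE.
- move=> A GA.
  exact: eigenline_character (@tens_act_is_linear _ _) line_neq0 lineE _ GA.
- exact: eigenline_one_dim (@tens_act_is_linear _ _) line1_neq0 line1E.
Qed.
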